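(* The following are equivalent for any split graph $G$: (1) $G$ is box-perfect; (2) no graph in $\mathcal S$ is an induced subgraph of $G$; (3) $G$ is totally unimodular.
   Context: All graphs are finite and simple. A graph is split if its vertex set can be partitioned into a clique and a stable set. Box-perfectness. A rational system $A\boldsymbol x\le \boldsymbol b$ is totally dual integral (TDI) if the minimum in $\max\{\boldsymbol w^T\boldsymbol x: A\boldsymbol x\le \boldsymbol b\}=\min\{\boldsymbol y^T\boldsymbol b:\boldsymbol y^TA=\boldsymbol w^T,\ \boldsymbol y\ge \boldsymbol 0\}$ has an integral optimal solution for every integral vector $\boldsymbol w$ for which the minimum is finite. It is box-TDI if the system $A\boldsymbol x\le \boldsymbol b$, $\boldsymbol l\le \boldsymbol x\le \boldsymbol u$ is TDI for all vectors $\boldsymbol l,\boldsymbol u$ each of whose coordinates is a rational number or $\pm\infty$. For a graph $G$, $A_G$ is the clique-vertex incidence matrix of $G$ (rows indexed by all cliques, columns by vertices). $G$ is box-perfect if the system $A_G\boldsymbol x\le \boldsymbol 1$, $\boldsymbol x\ge \boldsymbol 0$ is box-TDI. Totally unimodular graphs. A matrix is totally unimodular if every square submatrix has determinant $0$ or $\pm1$. $B_G$ is the submatrix of $A_G$ obtained by keeping only the rows corresponding to (inclusionwise) maximal cliques. $G$ is totally unimodular if $B_G$ is. The class $\mathcal Q$. For a bipartite graph $G=(U,V,E)$ with colour classes $U=\{u_1,\dots,u_m\}$, $V=\{v_1,\dots,v_n\}$, the biadjacency matrix is the $m\times n$ $\{0,1\}$-matrix $M$ with $M_{i,j}=1$ iff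 $u_iv_j\in E$. $\mathcal Q$ is the set of bipartite graphs $G=(U,V,E)$ whose biadjacency matrix is not totally unimodular but all of whose proper submatrices are totally unimodular. Bipartite graphs come with their bipartition $(U,V)$, and induced subgraphs inherit it. The class $\mathcal S$. $\mathcal Q_1$ consists of all $G=(U,V,E)\in\mathcal Q$ such that $U$ has a vertex adjacent to all vertices of $V$. $\mathcal Q_2$ consists of all $G=(U,V,E)\in\mathcal Q\setminus\mathcal Q_1$ such that the graph obtained from $G$ by adding a new vertex (to $U$) adjacent to all vertices of $V$ does not contain any graph in $\mathcal Q_1$ as an induced subgraph. $\mathcal S$ consists of all graphs constructed as follows: take $G'=(U,V,E')\in\mathcal Q_1\cup\mathcal Q_2$ and the complete graph $G''=(V,E'')$ on $V$, and let $G=(U\cup V,E'\cup E'')$; if there exists $u\in U$ with $N_{G'}(u)=V$ then $G-u$ belongs to $\mathcal S$; otherwise $G$ belongs to $\mathcal S$. *)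

(* Defs.v *)
From HB Require Import structures.
From mathcomp Require Import all_boot all_order all_algebra.
From mathcomp Require Import constructive_ereal.

Set Implicit Arguments.
Unset Strict Implicit.
Unset Printing Implicit Defensive.

Import Order.TTheory GRing.Theory Num.Theory.

Local Open Scope ring_scope.

Record sgraph := SGraph {
  svertex :> finType;
  sedge : rel svertex;
  sedge_sym : symmetric sedge;
  sedge_irrefl : irreflexive sedge }.

Definition clique (G : sgraph) (K : {set G}) : bool :=
  [forall x in K, forall y in K, (x != y) ==> sedge x y].

Definition stable (G : sgraph) (S : {set G}) : bool :=
  [forall x in S, forall y in S, ~~ sedge x y].

Definition split_graph (G : sgraph) : Prop :=
  exists K : {set G}, clique K /\ stable (~: K).

(* "H is an induced subgraph of G", up to isomorphism. *)
Definition induced_subgraph (H G : sgraph) : Prop :=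
  exists f : H -> G,
    injective f /\ forall x y, sedge (f x) (f y) = sedge x y.

Section DeleteVertex.
Variables (G : sgraph) (u : G).
Definition del_edge : rel {x : G | x != u} := fun x y => sedge (val x) (val y).
Fact del_edge_sym : symmetric del_edge.
Proof. by move=> x y; apply: sedge_sym. Qed.
Fact del_edge_irrefl : irreflexive del_edge.
Proof. by move=> x; apply: sedge_irrefl. Qed.
Definition del_vertex : sgraph := SGraph del_edge_sym del_edge_irrefl.
End DeleteVertex.

(* For max {w x : A x <= b} = min {y b : y A = w, y >= 0}; "the minimum is
   finite" is rendered as: the minimum is attained. *)
Section TotalDualIntegrality.
Variables m n : nat.
Implicit Types (A : 'M[rat]_(m, n)) (b : 'cV[rat]_m) (w : 'rV[int]_n).

Definition dual_feasible A w (y : 'rV[rat]_m) : Prop :=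
  y *m A = map_mx intr w /\ forall i, 0 <= y 0 i.

Definition dual_optimal A b w (y : 'rV[rat]_m) : Prop :=
  dual_feasible A w y /\
  forall z, dual_feasible A w z -> (y *m b) 0 0 <= (z *m b) 0 0.

Definition TDI A b : Prop :=
  forall w, (exists y, dual_optimal A b w y) ->
  exists y : 'rV[int]_m, dual_optimal A b w (map_mx intr y).
End TotalDualIntegrality.

(* The system A x <= b, x <= u, - x <= - l, where an infinite bound
   contributes no row. The values l_j = +oo and u_j = -oo are left out: they
   make the system infeasible, so that the minimum is never finite. *)
Definition box_TDI m n (A : 'M[rat]_(m, n)) (b : 'cV[rat]_m) : Prop :=
  forall l u : 'cV[\bar rat]_n,
  (forall j, l j 0%R < +oo)%E -> (forall j, -oo < u j 0%R)%E ->
  let fl := @enum_val _ [set j | l j 0 \is a fin_num] in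
  let fu := @enum_val _ [set j | u j 0 \is a fin_num] in
  TDI (col_mx A (col_mx (rowsub fu 1%:M) (- rowsub fl 1%:M)))
      (col_mx b (col_mx (rowsub fu (map_mx fine u))
                        (- rowsub fl (map_mx fine l)))).

(* Rows: the members of F; columns: the points of T. *)
Definition incidence_mx (T : finType) (F : {set {set T}}) :
    'M[rat]_(#|F|, #|T|) :=
  \matrix_(i < #|F|, j < #|T|) (enum_val j \in (enum_val i : {set T}))%:R.

Definition clique_mx (G : sgraph) := incidence_mx [set K : {set G} | clique K].

Definition maxclique_mx (G : sgraph) :=
  incidence_mx [set K : {set G} | maxset (@clique G) K].

Definition box_perfect (G : sgraph) : Prop :=
  box_TDI (col_mx (clique_mx G) (- 1%:M)) (col_mx (const_mx 1) 0).

(* A submatrix is given by injective choices of rows and columns; their order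
   only affects determinants by a sign. *)
Definition totally_unimodular m n (A : 'M[rat]_(m, n)) : Prop :=
  forall k (f : 'I_k -> 'I_m) (g : 'I_k -> 'I_n),
  injective f -> injective g -> \det (mxsub f g A) \in [:: 0; 1; -1].

Definition totally_unimodular_graph (G : sgraph) : Prop :=
  totally_unimodular (maxclique_mx G).

(* A bipartite graph with its ordered bipartition (U, V): only the U-V
   adjacencies are recorded. *)
Record bigraph := BiGraph {
  bU : finType;
  bV : finType;
  badj : bU -> bV -> bool }.

(* Colour classes are respected: U goes to U and V goes to V. *)
Definition bi_induced_subgraph (H B : bigraph) : Prop :=
  exists (f : bU H -> bU B) (g : bV H -> bV B),
    [/\ injective f, injective g & forall x y, badj (f x) (g y) = badj x y].

Definition biadjacency_mx (B : bigraph) : 'M[rat]_(#|bU B|, #|bV B|) :=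
  \matrix_(i < #|bU B|, j < #|bV B|) (badj (enum_val i) (enum_val j))%:R.

Definition proper_submx_TU m n (A : 'M[rat]_(m, n)) : Prop :=
  forall p q (f : 'I_p -> 'I_m) (g : 'I_q -> 'I_n),
  injective f -> injective g -> (p < m)%N || (q < n)%N ->
  totally_unimodular (mxsub f g A).

Definition calQ (B : bigraph) : Prop :=
  ~ totally_unimodular (biadjacency_mx B) /\ proper_submx_TU (biadjacency_mx B).

Definition full_vertex (B : bigraph) (u : bU B) : Prop := forall v, badj u v.

Definition calQ1 (B : bigraph) : Prop :=
  calQ B /\ exists u : bU B, full_vertex u.

Definition add_full_vertex (B : bigraph) : bigraph :=
  @BiGraph (option (bU B)) (bV B)
    (fun o v => if o is Some u then badj u v else true).

Definition calQ2 (B : bigraph) : Prop :=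
  [/\ calQ B, ~ calQ1 B &
      forall H, calQ1 H -> ~ bi_induced_subgraph H (add_full_vertex B)].

(* The graph (U \cup V, E' \cup E'') with (V, E'') complete. *)
Section SplitGraphOf.
Variable B : bigraph.
Definition split_edge : rel (bU B + bV B)%type := fun x y =>
  match x, y with
  | inl u, inr v => badj u v
  | inr v, inl u => badj u v
  | inr v, inr v' => v != v'
  | inl _, inl _ => false
  end.
Fact split_edge_sym : symmetric split_edge.
Proof. by move=> [x|x] [y|y] //=; rewrite eq_sym. Qed.
Fact split_edge_irrefl : irreflexive split_edge.
Proof. by move=> [x|x] //=; rewrite eqxx. Qed.
Definition split_of : sgraph := SGraph split_edge_sym split_edge_irrefl.
End SplitGraphOf.

Inductive calS : sgraph -> Prop :=
| calS_del (B : bigraph) (u : bU B) :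
    calQ1 B \/ calQ2 B -> full_vertex u ->
    calS (@del_vertex (split_of B) (inl u))
| calS_keep (B : bigraph) :
    calQ1 B \/ calQ2 B -> ~ (exists u : bU B, full_vertex u) ->
    calS (split_of B).

(* Main.v *)
Require Import Defs.
From Stdlib Require Import Classical.
From mathcomp Require Import all_boot all_order all_algebra.
From mathcomp Require Import constructive_ereal.

(** Three implications are proved in a cycle.

    Box-perfect implies no induced graph from [calS]. For such a graph, built
    from a member (U, V) of the class Q, give every vertex of V the same weight
    c and every u in U the weight 1 - c |N(u)|, so that each star {u} + N(u) is
    a clique of weight 1; take c = 1 / |V| if U has a full vertex and c = 1 /
    (|V| + 1) otherwise. These weights satisfy all clique inequalities, and the
    tight cliques trace on V exactly the rows of the biadjacency matrix M. In
    the first case the full vertex gets weight 0, so it can be deleted, its row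
    being then traced by the clique V. Boxes that pin every coordinate outside V
    to its weight let the columns outside V be balanced by tight rows, so total
    dual integrality says that each integral vector in the cone of the rows of M
    is an integral combination of these rows. As M is nonsingular, this forces
    det M = 1 or -1, whereas a non-totally-unimodular matrix all of whose proper
    submatrices are totally unimodular is square with another determinant. See
    [split_obstruction], [obstruction_transfer], [box_perfect_integral_cone],
    [unimodular_of_integral_cone].

    No induced graph from [calS] implies totally unimodular. In a split graph
    with clique K and stable set S, a maximal clique is K or a closed
    neighbourhood of a vertex of S. Hence the maximal-clique matrix is, up to
    unit columns, made of rows of the biadjacency matrix of the bipartite graph
    (S, K) with a full vertex added to S. If it is not totally unimodular, a
    smallest bad square submatrix is a member of Q. Either some member of Q1 is
    induced in that bipartite graph, and only its full vertex may use the added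
    vertex; or none is, and then the member found has no full vertex, lies in
    (S, K), and belongs to Q2. In both cases a graph of [calS] is induced. See
    [TU_split], [calQ_square], [embed_in_split].

    Totally unimodular implies box-perfect. Unit rows preserve total
    unimodularity, and a totally unimodular system is totally dual integral: an
    optimal dual solution of least support uses linearly independent rows, hence
    solves a square unimodular system. The rows of nonmaximal cliques are
    implied by those of maximal cliques and x >= 0, with nonnegative integral
    multipliers and no change of cost. See [TU_unit_rows], [TU_TDI],
    [TDI_dominated]. *)

Set Implicit Arguments.
Unset Strict Implicit.
Unset Printing Implicit Defensive.

Import Order.TTheory GRing.Theory Num.Theory.

Local Open Scope ring_scope.

(** * Total unimodularity *)

Definition zero_or_sign (R : nzRingType) : seq R := [:: 0; 1; -1].

Lemma zero_or_signM (R : nzRingType) (x y : R) :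
  x \in zero_or_sign R -> y \in zero_or_sign R -> x * y \in zero_or_sign R.
Proof.
rewrite !inE => /or3P[]/eqP-> /or3P[]/eqP->;
  by rewrite ?mul0r ?mulr0 ?mul1r ?mulr1 ?mulrNN ?mulr1 eqxx ?orbT.
Qed.

Lemma zero_or_sign_expr (R : nzRingType) n (x : R) :
  x \in zero_or_sign R -> (-1) ^+ n * x \in zero_or_sign R.
Proof.
by apply: zero_or_signM; rewrite -signr_odd; case: odd;
  rewrite ?expr0 ?expr1 !inE eqxx ?orbT.
Qed.

Lemma TU_tr m n (A : 'M[rat]_(m, n)) :
  totally_unimodular A -> totally_unimodular A^T.
Proof. by move=> tuA k f g fI gI; rewrite -det_tr trmx_mxsub trmxK; apply: tuA. Qed.

(** Repeating a row or a column only creates vanishing determinants, so the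
    selections need not be injective. *)
Lemma TU_mxsub m n p q (A : 'M[rat]_(m, n)) (f : 'I_p -> 'I_m) (g : 'I_q -> 'I_n) :
  totally_unimodular A -> totally_unimodular (mxsub f g A).
Proof.
move=> tuA k f' g' _ _; rewrite -mxsub_comp.
have [fI|/injectivePn[i1 [i2 ne12 eq12]]] := boolP (injectiveb (f \o f')); last first.
  by rewrite (determinant_alternate ne12) ?inE // => j; rewrite !mxE eq12.
have [gI|/injectivePn[i1 [i2 ne12 eq12]]] := boolP (injectiveb (g \o g')); last first.
  rewrite -det_tr (determinant_alternate ne12) ?inE // => j.
  by rewrite !mxE eq12.
by apply: tuA; apply/injectiveP.
Qed.

(** A square submatrix that meets a unit row is expanded along it, which leaves
    at most one minor. *)
Lemma TU_unit_rows m n p (A : 'M[rat]_(m, n)) (A' : 'M[rat]_(p, n)) :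
  totally_unimodular A ->
  (forall i, (exists i', row i A' = row i' A) \/
     exists j c, c \in zero_or_sign rat /\ row i A' = c *: delta_mx 0 j) ->
  totally_unimodular A'.
Proof.
move=> tuA rowsA'; elim=> [|k IHk] f g fI gI; first by rewrite det_mx00.
have [/forallP oldP|] := boolP [forall i, [exists i', row (f i) A' == row i' A]].
  have /fin_all_exists[h hP] i : exists i', row (f i) A' = row i' A.
    by have /existsP[i' /eqP] := oldP i; exists i'.
  have ->: mxsub f g A' = mxsub h g A.
    by apply/matrixP=> i j; have /rowP/(_ (g j)) := hP i; rewrite !mxE.
  by have := TU_mxsub h g tuA (@inj_id 'I_k.+1) (@inj_id 'I_k.+1); rewrite mxsub_id.
rewrite negb_forall => /existsP[i notold].
have [[i' eqi]|[j0 [c [c3 eqi]]]] := rowsA' (f i).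
  by case/existsP: notold; exists i'; apply/eqP.
have entry j : mxsub f g A' i j = c * (g j == j0)%:R.
  by have /rowP/(_ (g j)) := eqi; rewrite !mxE.
have [j /eqP gj|nog] := pickP (fun j => g j == j0); last first.
  rewrite (expand_det_row _ i) big1 ?inE // => j _.
  by rewrite entry nog mulr0 mul0r.
rewrite (expand_det_row _ i) (bigD1 j) //= big1 ?addr0; last first.
  move=> j' nej; rewrite entry -gj (inj_eq gI) (negPf nej).
  by rewrite mulr0 mul0r.
rewrite entry gj eqxx mulr1; apply: zero_or_signM => //; apply: zero_or_sign_expr.
have ->: row' i (col' j (mxsub f g A')) = mxsub (f \o lift i) (g \o lift j) A'.
  by apply/matrixP=> a b; rewrite !mxE.
by apply: IHk; apply: inj_comp => //; apply: lift_inj.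
Qed.

(** * Totally unimodular systems are totally dual integral *)

Section TUTDI.
Variables (m n : nat).
Implicit Types (A : 'M[rat]_(m, n)) (b : 'cV[rat]_m) (w : 'rV[int]_n).

Definition supp (y : 'rV[rat]_m) : {set 'I_m} := [set i | y 0 i != 0].

(** The ratio test: move along d until the first coordinate vanishes. *)
Lemma shrink_support A w (y d : 'rV[rat]_m) :
  dual_feasible A w y -> d *m A = 0 -> supp d \subset supp y ->
  (exists i, d 0 i < 0) ->
  exists2 t, 0 < t & dual_feasible A w (y + t *: d) /\
     supp (y + t *: d) \proper supp y.
Proof.
move=> [yA y0] dA sub [i0 di0].
pose r i := y 0 i / - d 0 i.
have [i di imin] := @arg_minP _ _ _ i0 (fun i => d 0 i < 0) r di0.
have yi : 0 < y 0 i.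
  rewrite lt0r y0 andbT.
  have /(subsetP sub): i \in supp d by rewrite inE lt_eqF.
  by rewrite inE.
have t0 : 0 < r i by rewrite divr_gt0 // oppr_gt0.
exists (r i) => //; split; first split.
- by rewrite mulmxDl -scalemxAl dA scaler0 addr0.
- move=> j; rewrite !mxE; have [dj|dj] := ltP (d 0 j) 0; last first.
    by rewrite addr_ge0 // mulr_ge0 // ltW.
  have := imin j dj; rewrite {2}/r ler_pdivlMr ?oppr_gt0 // mulrN.
  by rewrite -subr_ge0 opprK.
- apply/properP; split.
    apply/subsetP=> j; rewrite !inE !mxE; apply: contra => /eqP yj.
    have /eqP-> : d 0 j == 0.
      apply/negPn/negP => dj; have /(subsetP sub) : j \in supp d by rewrite inE.
      by rewrite inE yj eqxx.
    by rewrite yj mulr0 addr0.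
  exists i; first by rewrite inE gt_eqF.
  rewrite inE !mxE negbK /r invrN mulrN mulNr mulfVK ?subrr //.
  by rewrite lt_eqF.
Qed.

(** A linear dependency among the rows of the support is a direction d along
    which y stays dual feasible. If d has a negative entry and does not increase
    the cost, the ratio test yields an optimum of smaller support; if d is
    nonnegative, optimality of y makes its cost nonnegative. Applying this to
    both d and - d leaves no nonzero d. *)
Lemma support_rows_free A b w (y : 'rV[rat]_m) :
  dual_optimal A b w y ->
  (forall z, dual_optimal A b w z -> (#|supp y| <= #|supp z|)%N) ->
  row_free (rowsub (@enum_val _ (supp y)) A).
Proof.
move=> [feasy opty] miny; rewrite -kermx_eq0; set e := @enum_val _ _.
have eI : injective e := @enum_val_inj _ _.
apply/eqP/row_matrixP => r; rewrite row0; set v := row r _.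
apply/eqP/negPn/negP => v_neq0.
have vA : v *m rowsub e A = 0 by rewrite /v -row_mul mulmx_ker row0.
move: v v_neq0 vA => v v_neq0 vA {r}.
pose d := v *m rowsub e 1%:M.
have dA : d *m A = 0 by rewrite /d -mulmxA -rowsubE.
have dsub : supp d \subset supp y.
  apply/subsetP => i; rewrite inE; apply: contraNT => yi.
  rewrite mxE big1 // => j _; rewrite !mxE.
  case: eqP => [eqj|]; last by rewrite mulr0.
  by case/negP: yi; rewrite -eqj enum_valP.
have d_neq0 : exists i, d 0 i != 0.
  have [j vj] : exists j, v 0 j != 0.
    apply/existsP; apply: contraNT v_neq0; rewrite negb_exists => /forallP v0.
    by apply/eqP/rowP => j; rewrite [RHS]mxE; have /negPn/eqP := v0 j.
  exists (e j); rewrite mxE (bigD1 j) //= !mxE eqxx mulr1 big1 ?addr0 //.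
  by move=> j' nej; rewrite !mxE (inj_eq eI) (negPf nej) mulr0.
have cheap_ge0 (c : 'rV[rat]_m) : c *m A = 0 -> supp c \subset supp y ->
    (c *m b) 0 0 <= 0 -> forall i, 0 <= c 0 i.
  move=> cA csub cb i; rewrite leNgt; apply/negP => ci.
  have [|t t0 [feas prop]] := shrink_support feasy cA csub; first by exists i.
  have := miny (y + t *: c); rewrite leqNgt proper_card //= => smaller.
  suff: false by []; apply: smaller.
  split=> // z /opty; apply: le_trans.
  by rewrite mulmxDl -scalemxAl [X in X <= _]mxE gerDl mxE mulr_ge0_le0 // ltW.
have suppN (c : 'rV[rat]_m) : supp (- c) = supp c.
  by apply/setP=> i; rewrite !inE mxE oppr_eq0.
have cost_ge0 (c : 'rV[rat]_m) : c *m A = 0 -> (forall i, 0 <= c 0 i) -> 0 <= (c *m b) 0 0.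
  move=> cA c0; have := opty (y + c); rewrite mulmxDl [in X in _ <= X]mxE lerDl; apply.
  case: feasy => yA y0; split; first by rewrite mulmxDl cA addr0.
  by move=> i; rewrite mxE addr_ge0.
wlog db : d dA dsub d_neq0 / (d *m b) 0 0 <= 0.
  move=> IH; have [|/ltW db] := leP ((d *m b) 0 0) 0; first exact: IH.
  apply: (IH (- d)); rewrite ?mulNmx ?dA ?oppr0 ?suppN //
    ?[(- _ : 'M__) _ _]mxE ?oppr_le0 //.
  by case: d_neq0 => i di; exists i; rewrite mxE oppr_eq0.
have d0 := cheap_ge0 d dA dsub db.
have db0 : (d *m b) 0 0 = 0 by apply: le_anti; rewrite db cost_ge0.
have Nd0 i : 0 <= (- d) 0 i.
  by apply: cheap_ge0; rewrite ?mulNmx ?dA ?oppr0 ?suppN // mxE db0 oppr0.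
case: d_neq0 => i; rewrite eq_le d0 andbT; have := Nd0 i.
by rewrite mxE oppr_ge0 => ->.
Qed.

(** By Cramer's rule. *)
Lemma integral_of_unimodular k (M : 'M[int]_k) (v : 'rV[rat]_k) (w : 'rV[int]_k) :
  \det M \in [:: 1; -1] -> v *m map_mx intr M = map_mx intr w ->
  exists z : 'rV[int]_k, v = map_mx intr z.
Proof.
move=> detM vM; exists (\det M *: (w *m \adj M)).
have dd : \det M * \det M = 1.
  by move: detM; rewrite !inE => /orP[]/eqP->; rewrite ?mulr1 ?mulrNN ?mulr1.
rewrite map_mxZ map_mxM /= -vM map_mx_adj -mulmxA mul_mx_adj det_map_mx.
by rewrite mul_mx_scalar scalerA -intrM dd scale1r.
Qed.

Lemma min_support A b w : (exists y, dual_optimal A b w y) ->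
  exists2 y, dual_optimal A b w y &
    forall z, dual_optimal A b w z -> (#|supp y| <= #|supp z|)%N.
Proof.
suff H N : forall y, dual_optimal A b w y -> (#|supp y| <= N)%N ->
    ~ ~ exists2 y, dual_optimal A b w y &
    forall z, dual_optimal A b w z -> (#|supp y| <= #|supp z|)%N.
  by case=> y opty; apply: NNPP; apply: (H _ y opty (leqnn _)).
elim: N => [|N IHN] y opty.
  by rewrite leqn0 => /eqP y0; apply; exists y => // z _; rewrite y0.
move=> yN nomin; apply: (nomin); exists y => // z optz.
rewrite leqNgt; apply/negP => zy; apply: (IHN z optz) => //.
by rewrite -ltnS (leq_trans zy).
Qed.

(** The rows in a least support are independent, so some square submatrix B on
    these rows is nonsingular, hence unimodular, and determines the optimum. *)
Lemma TU_TDI A b : totally_unimodular A -> TDI A b.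
Proof.
move=> tuA w /min_support[y opty miny].
have := support_rows_free opty miny.
set e := @enum_val _ _; move=> free.
have eI : injective e := @enum_val_inj _ _.
have full : row_full (rowsub e A)^T by rewrite /row_full mxrank_tr.
pose g := fullrankfun full.
have gI : injective g := @fullrankfun_inj _ _ _ _ full.
pose B := mxsub e g A.
have Bu : B \in unitmx.
  rewrite -unitmx_tr -row_full_unit.
  have -> : B^T = rowsub g (rowsub e A)^T by apply/matrixP => i j; rewrite !mxE.
  exact: fullrowsub_full.
have entries i j : A i j \in zero_or_sign rat.
  have := tuA 1%N (fun=> i) (fun=> j).
  by rewrite det_mx11 mxE; apply; move=> a b' _; rewrite !ord1.
(* The entries are integers, so taking floors recovers B. *)
pose Bz : 'M[int]_#|supp y| := map_mx Num.floor B.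
have BzE : map_mx intr Bz = B.
  apply/matrixP => i j; rewrite !mxE.
  by have := entries (e i) (g j); rewrite !inE => /or3P[]/eqP->.
have detBz : \det Bz \in [:: 1; -1].
  have := tuA _ e g eI gI; rewrite -/B; move: Bu.
  rewrite unitmxE unitfE -BzE det_map_mx !inE intr_eq0 => /negPf->.
  by rewrite -!(eqr_int rat) rmorphN rmorph1.
pose v := \row_j y 0 (e j).
have yE : y = v *m rowsub e 1%:M.
  apply/rowP => i; rewrite mxE.
  have [yi|yi] := boolP (i \in supp y).
    rewrite (bigD1 (enum_rank_in yi i)) //= big1 => [|j nej].
      by rewrite !mxE /e enum_rankK_in // eqxx mulr1 addr0.
    rewrite !mxE; case: eqP => [eqj|]; last by rewrite mulr0.
    by case/eqP: nej; apply: enum_val_inj; rewrite enum_rankK_in.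
  rewrite big1 => [|j _]; first by move: yi; rewrite inE negbK => /eqP.
  rewrite !mxE; case: eqP => [eqj|]; last by rewrite mulr0.
  by case/negP: yi; rewrite -eqj enum_valP.
have vB : v *m map_mx intr Bz = map_mx intr (colsub g w).
  have [[yA _] _] := opty.
  have -> : map_mx intr (colsub g w) = colsub g (y *m A).
    by rewrite yA; apply/matrixP => i j; rewrite !mxE.
  have -> : y *m A = v *m rowsub e A by rewrite [in RHS]rowsubE mulmxA -yE.
  rewrite BzE.
  by apply/matrixP => i j; rewrite !mxE; apply: eq_bigr => l _; rewrite !mxE.
have [z zE] := integral_of_unimodular detBz vB.
exists (z *m rowsub e 1%:M).
suff -> : map_mx intr (z *m rowsub e 1%:M) = y by [].
rewrite [RHS]yE map_mxM -zE; congr (_ *m _).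
by apply/matrixP => i j; rewrite !mxE; case: (_ == _).
Qed.
End TUTDI.

Lemma ler_mulmx_row m (y : 'rV[rat]_m) (u v : 'cV[rat]_m) :
  (forall i, 0 <= y 0 i) -> (forall i, u i 0 <= v i 0) ->
  (y *m u) 0 0 <= (y *m v) 0 0.
Proof. by move=> y0 uv; rewrite !mxE ler_sum // => i _; rewrite ler_wpM2l. Qed.

Lemma mulmx_row_ge0 m p (y : 'rV[rat]_m) (C : 'M[rat]_(m, p)) :
  (forall i, 0 <= y 0 i) -> (forall i j, 0 <= C i j) ->
  forall j, 0 <= (y *m C) 0 j.
Proof. by move=> y0 C0 j; rewrite mxE sumr_ge0 // => i _; rewrite mulr_ge0. Qed.

(** If each system implies the other by nonnegative combinations (D integral),
    then C carries optimal dual solutions of the first to the second, and D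
    carries the integral ones back. *)
Lemma TDI_equiv m p n (A : 'M[rat]_(m, n)) (b : 'cV[rat]_m)
    (A1 : 'M[rat]_(p, n)) (b1 : 'cV[rat]_p)
    (C : 'M[rat]_(m, p)) (D : 'M[int]_(p, m)) :
  (forall i j, 0 <= C i j) -> C *m A1 = A -> (forall i, (C *m b1) i 0 <= b i 0) ->
  (forall i j, 0 <= D i j) -> map_mx intr D *m A = A1 ->
  (forall i, (map_mx intr D *m b) i 0 <= b1 i 0) ->
  TDI A1 b1 -> TDI A b.
Proof.
move=> C0 CA Cb D0 DA Db tdi1 w [y [[yA y0] opty]].
have Dq0 i j : 0 <= (map_mx intr D : 'M[rat]_(p, m)) i j by rewrite mxE ler0z.
have optyC z : dual_feasible A1 w z -> (y *m C *m b1) 0 0 <= (z *m b1) 0 0.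
  move=> [zA z0]; apply: le_trans (ler_mulmx_row z0 Db).
  rewrite -mulmxA; apply: le_trans (ler_mulmx_row y0 Cb) _.
  rewrite mulmxA; apply: opty; split; first by rewrite -mulmxA DA.
  exact: mulmx_row_ge0.
have [|z [[zA z0] optz]] := tdi1 w.
  exists (y *m C); split=> //; split; first by rewrite -mulmxA CA.
  exact: mulmx_row_ge0.
exists (z *m D); rewrite map_mxM; split.
  by split; [rewrite -mulmxA DA | apply: mulmx_row_ge0].
move=> x feasx; rewrite -mulmxA.
apply: le_trans (ler_mulmx_row z0 Db) _.
apply: (@le_trans _ _ ((y *m C *m b1) 0 0)).
  apply: optz; split; first by rewrite -mulmxA CA.
  exact: mulmx_row_ge0.
rewrite -mulmxA; apply: le_trans (ler_mulmx_row y0 Cb) _; exact: opty.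
Qed.

Lemma rowsub1_ge0 (R : numDomainType) m n (h : 'I_m -> 'I_n) i j :
  0 <= (rowsub h 1%:M : 'M[R]_(m, n)) i j.
Proof. by rewrite !mxE ler0n. Qed.

Lemma block_mx_ge0 (R : numDomainType) m1 m2 n1 n2 (A : 'M[R]_(m1, n1)) (B : 'M_(m1, n2))
    (C : 'M_(m2, n1)) (D : 'M_(m2, n2)) :
  (forall i j, 0 <= A i j) -> (forall i j, 0 <= B i j) ->
  (forall i j, 0 <= C i j) -> (forall i j, 0 <= D i j) ->
  forall i j, 0 <= block_mx A B C D i j.
Proof.
move=> A0 B0 C0 D0 i j.
by case: (split_ordP i) => i' ->; case: (split_ordP j) => j' ->;
  rewrite ?block_mxEul ?block_mxEur ?block_mxEdl ?block_mxEdr.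
Qed.

Lemma map_rowsub1 m n (h : 'I_m -> 'I_n) :
  map_mx intr (rowsub h 1%:M : 'M[int]_(m, n)) = rowsub h 1%:M :> 'M[rat]_(m, n).
Proof. by apply/matrixP => i j; rewrite !mxE; case: (_ == _). Qed.

(** A row K i is B (h i) minus a nonnegative combination of unit rows, that is,
    B (h i) plus a combination of the rows of x >= 0, whose right-hand side is 0;
    so among rows of equal right-hand side only the dominating ones matter. *)
Lemma TDI_dominated m p n r (K : 'M[rat]_(m, n)) (B : 'M[rat]_(p, n)) c
    (X : 'M[rat]_(r, n)) (d : 'cV[rat]_r) (h : 'I_m -> 'I_p) (h' : 'I_p -> 'I_m) :
  (forall i j, K i j <= B (h i) j) -> rowsub h' K = B ->
  TDI (col_mx (col_mx B (- 1%:M)) X) (col_mx (col_mx (const_mx c) 0) d) ->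
  TDI (col_mx (col_mx K (- 1%:M)) X) (col_mx (col_mx (const_mx c) 0) d).
Proof.
move=> KB BE.
pose E := rowsub h B - K.
have E0 i j : 0 <= E i j by rewrite !mxE subr_ge0.
pose C := block_mx (block_mx (rowsub h 1%:M) E 0 (1%:M : 'M_n)) 0 0 (1%:M : 'M_r).
pose D : 'M[int]__ :=
  block_mx (block_mx (rowsub h' 1%:M) 0 0 (1%:M : 'M_n)) 0 0 (1%:M : 'M_r).
have const_id a b (g : 'I_a -> 'I_b) :
    rowsub g 1%:M *m const_mx c = const_mx c :> 'cV[rat]_a.
  by rewrite -rowsubE; apply/matrixP => i j; rewrite !mxE.
apply: (TDI_equiv (C := C) (D := D)).
- apply: block_mx_ge0; first apply: block_mx_ge0; move=> i j;
    by rewrite ?rowsub1_ge0 ?E0 // mxE ?ler0n.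
- rewrite /C !mul_block_col !mul0mx !mul1mx ?add0r ?addr0 -rowsubE.
  by rewrite mulmxN mulmx1 /E opprB addrC subrK.
- move=> i; rewrite /C !mul_block_col !mul0mx !mul1mx ?add0r ?addr0 const_id.
  by rewrite mulmx0 addr0.
- apply: block_mx_ge0; first apply: block_mx_ge0; move=> i j;
    by rewrite ?rowsub1_ge0 // mxE ?ler0n.
- rewrite /D !map_block_mx !map_mx1 !map_mx0 map_rowsub1.
  by rewrite !mul_block_col !mul0mx !mul1mx ?add0r ?addr0 -rowsubE BE.
- move=> i; rewrite /D !map_block_mx !map_mx1 !map_mx0 map_rowsub1.
  by rewrite !mul_block_col !mul0mx !mul1mx ?add0r ?addr0 const_id.
Qed.

Lemma TU_box_perfect (G : sgraph) : totally_unimodular_graph G -> box_perfect G.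
Proof.
move=> tuG l u _ _ fl fu.
have /fin_all_exists[h hP] (i : 'I_#|[set K : {set G} | clique K]|) :
    exists j : 'I_#|[set K | maxset (@clique G) K]|,
      enum_val i \subset (enum_val j : {set G}).
  have := enum_valP i; rewrite inE => /maxset_exists[M maxM subM].
  have Min : M \in [set K | maxset (@clique G) K] by rewrite inE.
  by exists (enum_rank_in Min M); rewrite enum_rankK_in.
have /fin_all_exists[h' h'P] (j : 'I_#|[set K | maxset (@clique G) K]|) :
    exists i : 'I_#|[set K : {set G} | clique K]|, enum_val i = enum_val j.
  have := enum_valP j; rewrite inE => /maxsetp clK.
  have Kin : enum_val j \in [set K : {set G} | clique K] by rewrite inE.
  by exists (enum_rank_in Kin (enum_val j)); rewrite enum_rankK_in.
apply: (@TDI_dominated _ _ _ _ _ (maxclique_mx G) _ _ _ h h').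
- move=> i j; rewrite !mxE; case: (boolP (_ \in enum_val i)) => [|_].
    by move/(subsetP (hP i)) ->.
  by rewrite ler0n.
- by apply/matrixP => i j; rewrite !mxE h'P.
have unitrow m (f : 'I_m -> 'I_#|G|) (i' : 'I_m) :
    row i' (rowsub f 1%:M) = delta_mx 0 (f i') :> 'rV[rat]__.
  by apply/rowP => j; rewrite !mxE eqxx eq_sym.
apply: TU_TDI; apply: (TU_unit_rows tuG) => i.
case: (split_ordP i) => {i} i ->; rewrite ?rowKu ?rowKd.
  case: (split_ordP i) => {i} i ->; rewrite ?rowKu ?rowKd.
    by left; exists i.
  by right; exists i, (-1); rewrite scaleN1r linearN /= row1.
case: (split_ordP i) => {i} i ->; rewrite ?rowKu ?rowKd.
  by right; exists (fu i), 1; rewrite scale1r unitrow.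
by right; exists (fl i), (-1); rewrite scaleN1r linearN /= unitrow.
Qed.

(** * Minimal bad submatrices and the class Q *)

Lemma TU_unit_cols m n p (A : 'M[rat]_(m, n)) (A' : 'M[rat]_(m, p)) :
  totally_unimodular A ->
  (forall j, (exists j', col j A' = col j' A) \/
     exists i c, c \in zero_or_sign rat /\ col j A' = c *: delta_mx i 0) ->
  totally_unimodular A'.
Proof.
move=> /TU_tr tuA colsA'; rewrite -[A']trmxK; apply: TU_tr.
apply: (TU_unit_rows tuA) => j; have [[j' eqj]|[i [c [c3 eqj]]]] := colsA' j.
  by left; exists j'; rewrite -!tr_col eqj.
by right; exists i, c; rewrite -tr_col eqj linearZ /= trmx_delta.
Qed.

Definition square_sub (B : bigraph) k (p : 'I_k -> bU B) (q : 'I_k -> bV B) :=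
  BiGraph (fun i j => badj (p i) (q j)).

Definition square_mx (B : bigraph) k (p : 'I_k -> bU B) (q : 'I_k -> bV B) : 'M[rat]_k :=
  \matrix_(i, j) (badj (p i) (q j))%:R.

Lemma TU_squareP (B : bigraph) :
  totally_unimodular (biadjacency_mx B) <->
  forall k (p : 'I_k -> bU B) (q : 'I_k -> bV B), injective p -> injective q ->
    \det (square_mx p q) \in zero_or_sign rat.
Proof.
split=> [tuB k p q pI qI|sqB k f g fI gI].
  have := tuB k (enum_rank \o p) (enum_rank \o q).
  have -> : mxsub (enum_rank \o p) (enum_rank \o q) (biadjacency_mx B) = square_mx p q.
    by apply/matrixP => i j; rewrite !mxE /= !enum_rankK.
  by apply; apply: inj_comp => //; apply: enum_rank_inj.
have -> : mxsub f g (biadjacency_mx B) = square_mx (enum_val \o f) (enum_val \o g).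
  by apply/matrixP => i j; rewrite !mxE.
by apply: sqB; apply: inj_comp => //; apply: enum_val_inj.
Qed.

Lemma calQ_square (B : bigraph) k (p : 'I_k -> bU B) (q : 'I_k -> bV B) :
  injective p -> injective q -> \det (square_mx p q) \notin zero_or_sign rat ->
  (forall l (p' : 'I_l -> bU B) (q' : 'I_l -> bV B), (l < k)%N ->
     injective p' -> injective q' -> \det (square_mx p' q') \in zero_or_sign rat) ->
  calQ (square_sub p q).
Proof.
move=> pI qI detpq min; split.
  move/TU_squareP => /(_ k id id (@inj_id _) (@inj_id _)); apply/negP.
  suff -> : square_mx (B := square_sub p q) id id = square_mx p q by [].
  by apply/matrixP => i j; rewrite !mxE.
move=> m n f g fI gI small l f' g' f'I g'I.
have -> : mxsub f' g' (mxsub f g (biadjacency_mx (square_sub p q))) =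
  square_mx (p \o (enum_val \o (f \o f'))) (q \o (enum_val \o (g \o g'))).
  by apply/matrixP => i j; rewrite !mxE.
have lem : (l <= m)%N by have := leq_card _ f'I; rewrite !card_ord.
have len : (l <= n)%N by have := leq_card _ g'I; rewrite !card_ord.
have small' : (m < k)%N || (n < k)%N by move: small; rewrite /= !card_ord.
apply: min; last 2 first.
- by apply: inj_comp => //; apply: inj_comp; [apply: enum_val_inj | apply: inj_comp].
- by apply: inj_comp => //; apply: inj_comp; [apply: enum_val_inj | apply: inj_comp].
by case/orP: small'; apply: leq_ltn_trans.
Qed.

Lemma TU_of_no_calQ (B : bigraph) :
  (forall k (p : 'I_k -> bU B) (q : 'I_k -> bV B),
     injective p -> injective q -> ~ calQ (square_sub p q)) ->
  totally_unimodular (biadjacency_mx B).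
Proof.
move=> noQ; apply/TU_squareP; elim/ltn_ind => k IH p q pI qI.
apply/negPn/negP => bad; apply: (noQ k p q pI qI).
by apply: calQ_square => // l p' q' lk; apply: IH.
Qed.

(** Were the bad submatrix proper, it would be totally unimodular itself; so the
    whole biadjacency matrix is square and bad. *)
Lemma calQ_squareP (B : bigraph) : calQ B ->
  exists k (p : 'I_k -> bU B) (q : 'I_k -> bV B),
  [/\ bijective p, bijective q & \det (square_mx p q) \notin zero_or_sign rat].
Proof.
move=> [notTU properTU].
have [k [f [g [fI gI bad]]]] : exists k (f : 'I_k -> 'I_#|bU B|) (g : 'I_k -> 'I_#|bV B|),
    [/\ injective f, injective g &
        \det (mxsub f g (biadjacency_mx B)) \notin zero_or_sign rat].
  apply: NNPP => none; apply: notTU => k f g fI gI.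
  by apply/negPn/negP => bad; apply: none; exists k, f, g.
have [kU kV] : (#|bU B| <= k)%N /\ (#|bV B| <= k)%N.
  apply/andP; rewrite [X in X && _]leqNgt [X in _ && X]leqNgt -negb_or.
  apply/negP => small; case/negP: bad.
  have := properTU _ _ f g fI gI small k id id (@inj_id _) (@inj_id _).
  by rewrite mxsub_id.
exists k, (enum_val \o f), (enum_val \o g); split.
- apply: inj_card_bij; last by rewrite card_ord.
  by apply: inj_comp fI; apply: enum_val_inj.
- apply: inj_card_bij; last by rewrite card_ord.
  by apply: inj_comp gI; apply: enum_val_inj.
suff <- : mxsub f g (biadjacency_mx B) = square_mx (enum_val \o f) (enum_val \o g) by [].
by apply/matrixP => i j; rewrite !mxE.
Qed.

(** Two equal rows would make the determinant vanish. *)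
Lemma calQ_twin_free (B : bigraph) (u u' : bU B) :
  calQ B -> badj u =1 badj u' -> u = u'.
Proof.
move=> /calQ_squareP[k [p [q [[p' pK p'K] _ bad]]]] twin.
apply/eqP/negPn/negP => neu; case/negP: bad.
have ne : p' u != p' u' by rewrite (can_eq p'K).
rewrite (determinant_alternate ne) ?inE // => j.
by rewrite !mxE !p'K twin.
Qed.

(** * Split graphs without induced members of S *)

Definition split_bigraph (G : sgraph) (K : {set G}) : bigraph :=
  @BiGraph {x | x \in ~: K} {x | x \in K} (fun s v => sedge (val s) (val v)).

Lemma clique_set (G : sgraph) (K : {set G}) :
  reflect (forall x y, x \in K -> y \in K -> x != y -> sedge x y) (clique K).
Proof.
apply: (iffP forall_inP) => [clK x y xK yK|clK x xK].
  by move/forall_inP/(_ y yK)/implyP: (clK x xK); apply.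
by apply/forall_inP => y yK; apply/implyP; apply: clK.
Qed.

(** The columns of K come from the bipartite graph, since a maximal clique meets
    K either in the neighbourhood of a vertex outside K or in all of K. A vertex
    outside K lies in a single maximal clique, its closed neighbourhood, so its
    column is a unit vector. *)
Lemma TU_split (G : sgraph) (K : {set G}) :
  clique K -> stable (~: K) ->
  totally_unimodular (biadjacency_mx (add_full_vertex (split_bigraph K))) ->
  totally_unimodular_graph G.
Proof.
move=> clK stS tuB.
have edgeK x y : x \in K -> y \in K -> x != y -> sedge x y.
  by move=> xK yK; move/forall_inP/(_ x xK)/forall_inP/(_ y yK)/implyP: clK; apply.
have edgeS x y : x \notin K -> y \notin K -> sedge x y = false.
  rewrite -!in_setC => xS yS.
  by move/forall_inP/(_ x xS)/forall_inP/(_ y yS)/negPf: stS.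
have maxP (Q : {set G}) x : maxset (@clique G) Q ->
    (forall y, y \in Q -> x != y -> sedge x y) -> x \in Q.
  move=> /maxsetP[/clique_set clQ maxQ] adjx.
  rewrite -(maxQ (x |: Q)) ?setU11 ?subsetUr //.
  apply/clique_set => y z; rewrite !inE => /orP[/eqP->|yQ] /orP[/eqP->|zQ].
  - by rewrite eqxx.
  - exact: adjx.
  - by rewrite eq_sym sedge_sym; apply: adjx.
  - exact: clQ.
have trace (Q : {set G}) : maxset (@clique G) Q ->
    exists o : bU (add_full_vertex (split_bigraph K)),
      forall v : bV (split_bigraph K), (val v \in Q) = badj o v.
  move=> maxQ; have clQ := clique_set _ (maxsetp maxQ).
  have [s /andP[sQ sK]|noS] := pickP [pred s | (s \in Q) && (s \notin K)].
    have sS : s \in ~: K by rewrite inE.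
    exists (Some (exist _ s sS)) => -[v vK] /=.
    have nesv : s != v by apply: contraNneq sK => ->.
    apply/idP/idP => [vQ|sv]; first exact: clQ.
    apply: maxP => // y yQ nevy.
    have [yK|yK] := boolP (y \in K); first exact: edgeK.
    have [<-|nesy] := eqVneq s y; first by rewrite sedge_sym.
    by have := clQ s y sQ yQ nesy; rewrite edgeS.
  exists None => -[v vK] /=; apply: maxP => // y yQ nevy; apply: edgeK => //.
  by have := noS y; rewrite /= yQ /= => /negbFE.
have private s (Q Q' : {set G}) : s \notin K -> maxset (@clique G) Q ->
    maxset (@clique G) Q' -> s \in Q -> s \in Q' -> Q = Q'.
  move=> sK.
  suff sub (P P' : {set G}) : maxset (@clique G) P -> maxset (@clique G) P' ->
      s \in P -> s \in P' -> P \subset P'.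
    by move=> mQ mQ' sQ sQ'; apply/eqP; rewrite eqEsubset !sub.
  move=> mP mP' sP sP'; apply/subsetP => x xP.
  have [<-//|nesx] := eqVneq s x.
  have sx : sedge s x by apply: (clique_set _ (maxsetp mP)).
  have xK : x \in K by apply: contraTT sx => xK; rewrite edgeS.
  apply: maxP => // y yP' nexy.
  have [yK|yK] := boolP (y \in K); first exact: edgeK.
  have [<-|nesy] := eqVneq s y; first by rewrite sedge_sym.
  by have := clique_set _ (maxsetp mP') s y sP' yP' nesy; rewrite edgeS.
pose rows := #|[set Q | maxset (@clique G) Q]|.
have /fin_all_exists[h hP] (i : 'I_rows) :
    exists o : bU (add_full_vertex (split_bigraph K)),
      forall v : bV (split_bigraph K), (val v \in (enum_val i : {set G})) = badj o v.
  by apply: trace; have := enum_valP i; rewrite inE.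
apply: (TU_unit_cols (TU_mxsub (enum_rank \o h) id tuB)) => j.
have [jK|jK] := boolP (enum_val j \in K).
  left; pose v : bV (split_bigraph K) := exist _ (enum_val j) jK.
  exists (enum_rank v); apply/colP => i; rewrite !mxE /= !enum_rankK.
  by rewrite (hP i v).
right; have [Q maxQ jQ] : {Q | maxset (@clique G) Q & [set enum_val j] \subset Q}.
  apply: maxset_exists; apply/clique_set => x y; rewrite !inE => /eqP-> /eqP->.
  by rewrite eqxx.
rewrite sub1set in jQ; have Qin : Q \in [set Q | maxset (@clique G) Q] by rewrite inE.
exists (enum_rank_in Qin Q), 1; split; first by [].
apply/colP => i; rewrite scale1r !mxE eqxx andbT; congr (_%:R); congr nat_of_bool.
apply/idP/eqP => [ji|->]; last by rewrite enum_rankK_in.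
apply: enum_val_inj; rewrite enum_rankK_in //.
by apply: (private (enum_val j)) => //; have := enum_valP i; rewrite inE.
Qed.

Lemma bi_induced_trans A B C :
  bi_induced_subgraph A B -> bi_induced_subgraph B C -> bi_induced_subgraph A C.
Proof.
move=> [f [g [fI gI fg]]] [f' [g' [f'I g'I fg']]].
by exists (f' \o f), (g' \o g); split=> [||x y]; rewrite /= ?fg' //; apply: inj_comp.
Qed.

Lemma induced_add_full B C :
  bi_induced_subgraph B C ->
  bi_induced_subgraph (add_full_vertex B) (add_full_vertex C).
Proof.
move=> [f [g [fI gI fg]]]; exists (omap f), g; split=> //.
- by move=> [x|] [y|] //= [] /fI->.
- by move=> [x|] y /=.
Qed.

Lemma induced_without_full B C :
  ~ (exists u : bU B, full_vertex u) ->
  bi_induced_subgraph B (add_full_vertex C) -> bi_induced_subgraph B C.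
Proof.
move=> nofull [f [g [fI gI fg]]].
have /fin_all_exists[f' f'P] u : exists u', f u = Some u'.
  case fu: (f u) => [u'|]; first by exists u'.
  by case: nofull; exists u => v; rewrite -fg fu.
exists f', g; split=> [u u' eqf|//|u v]; last by rewrite -fg f'P.
by apply: fI; rewrite !f'P eqf.
Qed.

(** The map f takes values in the stable side with the full vertex added as
    [None]; requiring that H avoid the preimage of [None] covers at once the
    graphs of [calS] with and without deleted full vertex. *)
Lemma embed_in_split (G H : sgraph) (K : {set G}) (B : bigraph)
    (e : H -> split_of B) (f : bU B -> option {x | x \in ~: K})
    (g : bV B -> {x | x \in K}) :
  clique K -> stable (~: K) ->
  injective e -> (forall x y, sedge (e x) (e y) = sedge x y) ->
  injective f -> injective g ->
  (forall u v, badj (b := add_full_vertex (split_bigraph K)) (f u) (g v) = badj u v) ->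
  (forall x u, e x = inl u -> f u <> None) ->
  induced_subgraph H G.
Proof.
move=> clK stK eI eE fI gI fgE noNone.
pose good (z : split_of B) y := match z with
  | inl u => if f u is Some s then y = val s else False
  | inr v => y = val (g v) end.
have /fin_all_exists[F FP] x : exists y, good (e x) y.
  case ex: (e x) => [u|v] /=; last by exists (val (g v)).
  by case fu: (f u) => [s|]; [exists (val s) | have := noNone x u ex].
have goodE z z' y y' : good z y -> good z' y' -> sedge y y' = sedge z z'.
  case: z => [u|v]; case: z' => [u'|v'] /=.
  - case: (f u) => // s; case: (f u') => // s' -> ->.
    by move/forall_inP/(_ _ (valP s))/forall_inP/(_ _ (valP s'))/negPf: stK.
  - by case fu: (f u) => [s|//] -> ->; rewrite -fgE fu.
  - by move=> ->; case fu: (f u') => [s|//] ->; rewrite sedge_sym -fgE fu.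
  - move=> -> ->; have [->|nev] := eqVneq v v'; first by rewrite !sedge_irrefl.
    transitivity true; last exact: esym.
    move/forall_inP/(_ _ (valP (g v)))/forall_inP/(_ _ (valP (g v')))/implyP: clK; apply.
    by apply: contraNneq nev => /val_inj/gI->.
have goodI z z' y : good z y -> good z' y -> z = z'.
  have cross (s : {x | x \in ~: K}) (v : {x | x \in K}) : val s <> val v.
    by move=> sv; have := valP s; rewrite sv in_setC (valP v).
  case: z => [u|v]; case: z' => [u'|v'] /=.
  - case fu: (f u) => [s|//] -> ; case fu': (f u') => [s'|//] /val_inj eqs.
    by congr inl; apply: fI; rewrite fu fu' eqs.
  - by case: (f u) => // s -> /cross.
  - by move=> ->; case: (f u') => // s /esym/cross.
  - by move=> -> /val_inj/gI->.
exists F; split=> [x y eqF|x y].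
  by apply/eI/(goodI _ _ (F x)); [| rewrite eqF]; apply: FP.
by rewrite (goodE (e x) (e y)) ?eE //; apply: FP.
Qed.

(** In a member of Q1 embedded with the added full vertex available, only the
    full vertex u of the member can be sent to the added one, by
    [calQ_twin_free]; this is why deleting u gives an induced subgraph. *)
Lemma TU_of_no_calS (G : sgraph) : split_graph G ->
  ~ (exists H : sgraph, calS H /\ induced_subgraph H G) ->
  totally_unimodular_graph G.
Proof.
move=> [K [clK stK]] noS.
have noQ1 B : calQ1 B -> ~ bi_induced_subgraph B (add_full_vertex (split_bigraph K)).
  move=> Q1B [f [g [fI gI fgE]]]; have [QB [u fullu]] := Q1B.
  apply: noS; exists (@del_vertex (split_of B) (inl u)).
  split; first by apply: calS_del; [left|].
  apply: (@embed_in_split _ (@del_vertex (split_of B) (inl u)) _ _ val _ _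
    clK stK val_inj _ fI gI fgE) => // x u' xu' fu'.
  have := valP x; rewrite xu' /= => /eqP; apply; congr inl.
  by apply: calQ_twin_free => // v; rewrite fullu -fgE fu'.
apply: (TU_split clK stK); apply: TU_of_no_calQ => k p q pI qI Qpq.
have ind : bi_induced_subgraph (square_sub p q) (add_full_vertex (split_bigraph K)).
  by exists p, q.
have nofull : ~ (exists u : bU (square_sub p q), full_vertex u).
  by move=> full; apply: (noQ1 _ (conj Qpq full) ind).
apply: noS; exists (split_of (square_sub p q)).
have ind' := induced_without_full nofull ind; split; last first.
  have [f [g [fI gI fgE]]] := ind'.
  apply: (embed_in_split (e := id) (f := Some \o f) clK stK _ _ _ gI) => //.
  by move=> u u' /= [/fI].
apply: calS_keep => //; right; split=> // [[]//|H H1 HB].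
by apply: (noQ1 H H1); apply: bi_induced_trans (induced_add_full ind').
Qed.

(** * Integral cones at a face of the clique polytope *)

(** A large multiple of the sum of the rows, added to a unit vector, lies in the cone
    of the rows. So every unit vector is an integral combination of the rows,
    and M has an integral inverse. *)
Lemma unimodular_of_integral_cone k (M : 'M[int]_k) :
  \det M != 0 ->
  (forall (y : 'rV[rat]_k) (w : 'rV[int]_k), (forall i, 0 <= y 0 i) ->
     y *m map_mx intr M = map_mx intr w -> exists z : 'rV[int]_k, z *m M = w) ->
  \det M \in zero_or_sign int.
Proof.
move=> detM cone.
pose Mq : 'M[rat]_k := map_mx intr M.
have Mu : Mq \in unitmx by rewrite unitmxE unitfE det_map_mx intr_eq0.
(* L bounds the negative entries of the inverse. *)
pose L := (\sum_i \sum_j (Num.truncn `|invmx Mq i j|%R).+1)%N.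
have Lle i j : - invmx Mq i j <= L%:R.
  apply: le_trans (ler_norm _) _; rewrite normrN.
  apply: le_trans (ltW (truncnS_gt _)) _; rewrite ler_nat /L.
  by rewrite (bigD1 i) //= (bigD1 j) //= -addnA leq_addr.
have rows j : exists z : 'rV[int]_k, z *m M = delta_mx 0 j.
  have [i||z zM] := cone (row j (invmx Mq) + const_mx L%:R)
    (delta_mx 0 j + const_mx L%:R *m M).
  - by rewrite !mxE -lerBlDl sub0r.
  - rewrite mulmxDl -row_mul mulVmx // row1 map_mxD map_delta_mx map_mxM map_const_mx.
    by rewrite rmorph_nat.
  exists (z - const_mx L%:R).
  by rewrite mulmxBl zM addrK.
have [z zP] := fin_all_exists rows.
have : (\matrix_j z j) *m M = 1%:M.
  by apply/row_matrixP => j; rewrite row_mul rowK zP row1.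
move/(congr1 determinant); rewrite det_mulmx det1 => /intUnitRing.unitzPl.
by rewrite !inE => /orP[] ->; rewrite ?orbT.
Qed.

(** Complementary slackness: y and x certify each other's optimality, hence every
    optimal dual solution, in particular an integral one, is supported on rows
    tight at x. *)
Lemma TDI_tight m n (A : 'M[rat]_(m, n)) (b : 'cV[rat]_m) (x : 'cV[rat]_n)
    (y : 'rV[rat]_m) (w : 'rV[int]_n) :
  TDI A b -> (forall i, (A *m x) i 0 <= b i 0) ->
  dual_feasible A w y -> (forall i, y 0 i != 0 -> (A *m x) i 0 = b i 0) ->
  exists z : 'rV[int]_m, map_mx intr z *m A = map_mx intr w /\
    forall i, z 0 i != 0 -> (A *m x) i 0 = b i 0.
Proof.
move=> tdi Ax feasy tighty; have [yA y0] := feasy.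
have yb : (y *m b) 0 0 = (map_mx intr w *m x) 0 0.
  rewrite -yA -mulmxA !mxE; apply: eq_bigr => i _.
  by have [->|/tighty->] := eqVneq (y 0 i) 0; rewrite ?mul0r.
have [|z [[zA z0] optz]] := tdi w.
  exists y; split=> // z [zA z0].
  by rewrite yb -zA -mulmxA ler_mulmx_row.
exists z; split=> // i zi; apply/eqP; rewrite eq_le Ax /=.
have slack j : true -> 0 <= (map_mx intr z : 'rV[rat]_m) 0 j * (b j 0 - (A *m x) j 0).
  by rewrite mulr_ge0 // subr_ge0.
have : \sum_j (map_mx intr z : 'rV[rat]_m) 0 j * (b j 0 - (A *m x) j 0) == 0.
  rewrite eq_le sumr_ge0 // andbT; under eq_bigr do rewrite mulrBr.
  have := optz _ feasy; rewrite yb -zA -mulmxA.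
  by rewrite [X in X <= _]mxE [X in _ <= X]mxE -subr_le0 -sumrB.
rewrite psumr_eq0 // => /allP/(_ i (mem_index_enum _)) /=.
by rewrite mulf_eq0 mxE intr_eq0 (negPf zi) /= subr_eq0 => /eqP->.
Qed.

Lemma clique_mx_mul (G : sgraph) (x : G -> rat) i :
  (clique_mx G *m \col_j x (enum_val j)) i 0 = \sum_(a in (enum_val i : {set G})) x a.
Proof.
rewrite mxE [RHS]big_mkcond [RHS](reindex _ (onW_bij _ (@enum_val_bij G))) /=.
by apply: eq_bigr => j _; rewrite !mxE; case: ifP; rewrite ?mul1r ?mul0r.
Qed.

(** Both bounds are set to x outside F and to infinity on F. The columns outside
    F are then balanced by the rows of the lower bounds, which are tight
    at x, while on F no bound is present and the rows of x >= 0 are not tight, so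
    only tight cliques contribute there. *)
Lemma box_perfect_integral_cone (G : sgraph) k (Q : 'I_k -> {set G}) (x : G -> rat)
    (F : {set G}) (y : 'rV[rat]_k) (w : G -> int) :
  box_perfect G ->
  (forall a, 0 <= x a) -> (forall a, a \in F -> 0 < x a) ->
  (forall K, clique K -> \sum_(a in K) x a <= 1) ->
  (forall i, clique (Q i)) -> (forall i, \sum_(a in Q i) x a = 1) ->
  (forall i, 0 <= y 0 i) ->
  (forall a, a \in F -> \sum_i y 0 i * (a \in Q i)%:R = (w a)%:~R) ->
  exists z : 'I_#|[set K : {set G} | clique K]| -> int,
    (forall i, z i != 0 -> \sum_(a in (enum_val i : {set G})) x a = 1) /\
    (forall a, a \in F ->
       \sum_i z i * (a \in (enum_val i : {set G}))%:R = w a).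
Proof.
move=> boxG x0 xF xK clQ Q1 y0 yw.
pose n := #|svertex G|.
pose l : 'cV[\bar rat]_n := \col_j if enum_val j \in F then -oo%E else (x (enum_val j))%:E.
pose u : 'cV[\bar rat]_n := \col_j if enum_val j \in F then +oo%E else (x (enum_val j))%:E.
have lfin j : (l j 0 \is a fin_num) = (enum_val j \notin F).
  by rewrite mxE; case: (_ \in F).
have ufin j : (u j 0 \is a fin_num) = (enum_val j \notin F).
  by rewrite mxE; case: (_ \in F).
have l_lt j : (l j 0%R < +oo)%E by rewrite mxE; case: ifP => // _; rewrite ltry.
have u_gt j : (-oo < u j 0%R)%E by rewrite mxE; case: ifP => // _; rewrite ltNyr.
have := boxG l u l_lt u_gt; cbv zeta.
set fu := @enum_val _ [set j | u j 0 \is a fin_num].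
set fl := @enum_val _ [set j | l j 0 \is a fin_num].
rewrite -/n; set N := #|_|; set A := col_mx _ _; set b := col_mx _ _ => tdi.
have fuF i : enum_val (fu i) \notin F by have := enum_valP i; rewrite inE ufin.
have flF i : enum_val (fl i) \notin F by have := enum_valP i; rewrite inE lfin.
have /fin_all_exists[idx idxP] i : exists r : 'I_N, enum_val r = Q i.
  have Qin : Q i \in [set K : {set G} | clique K] by rewrite inE.
  by exists (enum_rank_in Qin (Q i)); rewrite enum_rankK_in.
pose xc : 'cV[rat]_n := \col_j x (enum_val j).
pose s (j : 'I_n) := \sum_i y 0 i * (enum_val j \in Q i)%:R.
pose Y : 'rV[rat]_(N + n + (#|[set j | u j 0 \is a fin_num]| +
                            #|[set j | l j 0 \is a fin_num]|)) :=
  row_mx (row_mx (y *m rowsub idx 1%:M) (0 : 'rV[rat]_n))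
         (row_mx 0 (\row_i s (fl i))).
pose W : 'rV[int]_n := \row_j if enum_val j \in F then w (enum_val j) else 0.
have AxE : A *m xc = col_mx (col_mx (clique_mx G *m xc) (- xc)) (dsubmx b).
  rewrite /A /b !mul_col_mx col_mxKd !mulNmx mul1mx -!rowsubE.
  congr (col_mx _ (col_mx _ (- _))); apply/colP => i; rewrite !mxE.
    by rewrite (negPf (fuF i)).
  by rewrite (negPf (flF i)).
have [||i|z [zA ztight]] := @TDI_tight _ _ A b xc Y W tdi.
- move=> i; rewrite AxE /b col_mxKd.
  case: (split_ordP i) => {i} i ->; rewrite !(col_mxEu _ _ i, col_mxEd _ _ i) //.
  case: (split_ordP i) => {i} i ->; rewrite !(col_mxEu _ _ i, col_mxEd _ _ i).
    by rewrite clique_mx_mul mxE xK //; have := enum_valP i; rewrite inE.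
  by rewrite !mxE oppr_le0.
- split.
    rewrite /Y /A !mul_row_col !mul0mx addr0 add0r mulmxN -mulmxA -rowsubE.
    apply/rowP => j; rewrite !mxE.
    have -> : \sum_i y 0 i * (rowsub idx (clique_mx G)) i j = s j.
      by apply: eq_bigr => i _; rewrite !mxE idxP.
    have [jF|jF] := boolP (enum_val j \in F).
      rewrite big1 ?subr0 => [|i _]; first exact: yw.
      rewrite !mxE.
      case: eqP => [eqj|]; last by rewrite mulr0.
      by case/negP: (flF i); rewrite eqj.
    have jl : j \in [set j | l j 0 \is a fin_num] by rewrite inE lfin.
    rewrite (bigD1 (enum_rank_in jl j)) //= big1 => [|i nei].
      by rewrite !mxE /fl enum_rankK_in // eqxx mulr1 addr0 subrr.
    rewrite !mxE; case: eqP => [eqj|]; last by rewrite mulr0.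
    by case/eqP: nei; apply: enum_val_inj; rewrite enum_rankK_in.
  have s0 j : 0 <= s j by apply: sumr_ge0 => i _; rewrite mulr_ge0 ?ler0n.
  move=> i; case: (split_ordP i) => {i} i ->; rewrite ?row_mxEl ?row_mxEr;
    case: (split_ordP i) => {i} i ->; rewrite ?row_mxEl ?row_mxEr.
  + by apply: mulmx_row_ge0 => // *; apply: rowsub1_ge0.
  + by rewrite mxE.
  + by rewrite mxE.
  + by rewrite mxE.
- rewrite AxE /b col_mxKd.
  case: (split_ordP i) => {i} i ->; rewrite !(col_mxEu _ _ i, col_mxEd _ _ i) //.
  case: (split_ordP i) => {i} i ->; rewrite !(col_mxEu _ _ i, col_mxEd _ _ i); last first.
    by rewrite !row_mxEl row_mxEr mxE eqxx.
  rewrite !row_mxEl clique_mx_mul [const_mx _ _ _]mxE mxE => nz.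
  have [i' /eqP <-|noi] := pickP (fun i' => idx i' == i); first by rewrite idxP.
  case/eqP: nz; apply: big1 => i' _; rewrite !mxE.
  by have := noi i' => ->; rewrite mulr0.
exists (fun i => z 0 (lshift _ (lshift _ i))); split=> [i /ztight|a aF].
  by rewrite AxE /b !col_mxEu clique_mx_mul mxE.
have := zA => /rowP/(_ (enum_rank a)).
pose z1 := lsubmx (lsubmx z); pose z2 := rsubmx (lsubmx z).
pose z3 := lsubmx (rsubmx z); pose z4 := rsubmx (rsubmx z).
have -> : map_mx intr z = row_mx (row_mx (map_mx intr z1) (map_mx intr z2))
    (row_mx (map_mx intr z3) (map_mx intr z4)) :> 'rV[rat]__.
  by rewrite !(map_lsubmx, map_rsubmx) !hsubmxK.
rewrite /A !mul_row_col !mulmxN mulmx1 !mxE enum_rankK aF.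
have -> : z 0 (lshift _ (rshift _ (enum_rank a))) = 0.
  apply/eqP/negPn/negP => /ztight; rewrite AxE /b !col_mxEu !col_mxEd !mxE enum_rankK.
  by move/eqP; rewrite oppr_eq0 gt_eqF // xF.
rewrite [X in _ + (X - _)]big1 => [|i _]; last first.
  rewrite !mxE; case: eqP => [eqa|]; last by rewrite mulr0.
  by have := fuF i; rewrite eqa enum_rankK aF.
rewrite [X in _ + (_ - X)]big1 => [|i _]; last first.
  rewrite !mxE; case: eqP => [eqa|]; last by rewrite mulr0.
  by have := flF i; rewrite eqa enum_rankK aF.
rewrite mulr0z subrr addr0 subr0 => zw; apply: (@intr_inj rat); rewrite -zw rmorph_sum.
by apply: eq_bigr => i _; rewrite rmorphM /= rmorph_nat !mxE enum_rankK.
Qed.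

(** * Obstructions to box-perfectness *)

(** The point x of the clique polytope makes the cliques Q i tight, and
    the incidence vectors of its tight cliques, restricted to the v j, are the
    rows of a matrix that is not unimodular. *)
Record box_obstruction (G : sgraph) k (v : 'I_k -> G) (Q : 'I_k -> {set G})
    (x : G -> rat) : Prop := BoxObstruction {
  obs_inj : injective v;
  obs_ge0 : forall a, 0 <= x a;
  obs_gt0 : forall j, 0 < x (v j);
  obs_le1 : forall K, clique K -> \sum_(a in K) x a <= 1;
  obs_clique : forall i, clique (Q i);
  obs_tight : forall i, \sum_(a in Q i) x a = 1;
  obs_trace : forall K, clique K -> \sum_(a in K) x a = 1 ->
    exists i, forall j, (v j \in K) = (v j \in Q i);
  obs_det : \det (\matrix_(i, j) (v j \in Q i)%:R : 'M[int]_k) \notin zero_or_sign int }.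

Lemma obstruction_not_box_perfect (G : sgraph) k (v : 'I_k -> G) (Q : 'I_k -> {set G}) x :
  box_obstruction v Q x -> ~ box_perfect G.
Proof.
move=> [vI x0 xv xK clQ Q1 trace detM] boxG; case/negP: (detM).
set M := (\matrix_(i, j) _)%R in detM *.
apply: unimodular_of_integral_cone.
  by apply: contraNneq detM => ->.
move=> y w y0 yM.
pose F : {set G} := v @: [set: 'I_k].
pose wG (a : G) := \sum_(j | v j == a) w 0 j.
have wGv j : wG (v j) = w 0 j.
  by rewrite /wG (eq_bigl (pred1 j)) ?big_pred1_eq // => j'; rewrite /= (inj_eq vI).
have [|a aF|z [ztight zw]] := box_perfect_integral_cone
    (Q := Q) (x := x) (F := F) (y := y) (w := wG) boxG x0 _ xK clQ Q1 y0.
- by move=> a /imsetP[j _ ->].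
- case/imsetP: aF => j _ ->; rewrite wGv; have /rowP/(_ j) := yM; rewrite !mxE => <-.
  by apply: eq_bigr => i _; rewrite !mxE rmorph_nat.
have /fin_all_exists[r rP] i : exists r : 'rV[int]_k,
    r *m M = \row_j (z i * (v j \in (enum_val i : {set G}))%:R).
  have [->|zi] := eqVneq (z i) 0.
    by exists 0; rewrite mul0mx; apply/rowP => j; rewrite !mxE mul0r.
  have clK : clique (enum_val i : {set G}) by have := enum_valP i; rewrite inE.
  have [i' i'P] := trace _ clK (ztight i zi).
  exists (z i *: delta_mx 0 i'); rewrite -scalemxAl -rowE.
  by apply/rowP => j; rewrite !mxE i'P.
exists (\sum_i r i); rewrite mulmx_suml; apply/rowP => j.
rewrite summxE -wGv -zw ?imset_f //.
by apply: eq_bigr => i _; rewrite rP mxE.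
Qed.

(** An obstruction only depends on the subgraph induced by the support of x, here
    contained in the image of T. *)
Lemma obstruction_transfer (T H G : sgraph) (a : T -> H) (b : T -> G) k
    (v : 'I_k -> H) Q x :
  injective a -> (forall s t, sedge (a s) (a t) = sedge s t) ->
  injective b -> (forall s t, sedge (b s) (b t) = sedge s t) ->
  (forall h, x h != 0 -> exists t, a t = h) ->
  box_obstruction v Q x ->
  exists v' Q' x', @box_obstruction G k v' Q' x'.
Proof.
move=> aI aE bI bE supp [vI x0 xv xK clQ Q1 trace detM].
have /fin_all_exists[t tP] j : exists t, a t = v j by apply: supp; rewrite gt_eqF.
pose x' g := \sum_(s | b s == g) x (a s).
have wt' (K : {set G}) : \sum_(g in K) x' g = \sum_(h in a @: (b @^-1: K)) x h.
  rewrite big_imset /=; last by move=> s s' _ _; apply: aI.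
  rewrite [RHS](partition_big b (mem K)) /=; last by move=> s; rewrite inE.
  apply: eq_bigr => g gK; apply: eq_bigl => s.
  by rewrite inE; case: eqP => [->|]; rewrite ?andbF // gK.
have wt (K : {set H}) : \sum_(h in K) x h = \sum_(h in a @: (a @^-1: K)) x h.
  rewrite [LHS]big_mkcond [RHS]big_mkcond; apply: eq_bigr => h _.
  case: ifP => hK; case: ifP => // /imsetP hK'.
    apply/eqP/negPn/negP => /supp[s eqs]; apply: hK'; exists s => //.
    by rewrite inE eqs.
  by case: hK' => s; rewrite inE => sK eqs; rewrite -eqs hK in sK.
have pull_clique (K : {set G}) : clique K -> clique (a @: (b @^-1: K)).
  move=> /clique_set clK; apply/clique_set => _ _ /imsetP[s sK ->] /imsetP[s' s'K ->] nes.
  rewrite !inE in sK s'K; rewrite aE -bE; apply: clK => //.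
  by apply: contra_neq nes => /bI->.
have pull_push (K : {set H}) : a @: (b @^-1: (b @: (a @^-1: K))) = a @: (a @^-1: K).
  suff -> : b @^-1: (b @: (a @^-1: K)) = a @^-1: K by [].
  by apply/setP => s; rewrite inE mem_imset.
exists (b \o t), (fun i => b @: (a @^-1: Q i)), x'; split.
- by apply: inj_comp => // j j' eqt; apply: vI; rewrite -!tP eqt.
- by move=> g; apply: sumr_ge0.
- move=> j; rewrite /x' (eq_bigl (pred1 (t j))) ?big_pred1_eq ?tP //.
  by move=> s; rewrite /= (inj_eq bI).
- by move=> K clK; rewrite wt' xK // pull_clique.
- move=> i; apply/clique_set => _ _ /imsetP[s sQ ->] /imsetP[s' s'Q ->] nes.
  rewrite !inE in sQ s'Q; rewrite bE -aE; apply: (clique_set _ (clQ i)) => //.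
  by apply: contra_neq nes => /aI->.
- by move=> i; rewrite wt' pull_push -wt.
- move=> K clK; rewrite wt' => /(trace _ (pull_clique K clK))[i iP]; exists i => j.
  by rewrite /= mem_imset // inE tP -iP -tP mem_imset // inE.
move: detM; suff -> : \matrix_(i, j) (v j \in Q i)%:R =
  \matrix_(i, j) ((b \o t) j \in b @: (a @^-1: Q i))%:R :> 'M[int]_k by [].
apply/matrixP => i j; rewrite !mxE.
by rewrite /= mem_imset // inE tP.
Qed.

(** * The graphs of S are obstructions *)

Section SplitObstruction.
Variables (B : bigraph) (c : rat).
Hypothesis c_gt0 : 0 < c.
Hypothesis c_le1 : c * #|bV B|%:R <= 1.
Hypothesis c_full : c * #|bV B|%:R = 1 -> exists u : bU B, full_vertex u.

Definition star (u : bU B) : {set split_of B} :=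
  [set z | match z with inl u' => u' == u | inr v => badj u v end].

Definition V_side : {set split_of B} :=
  [set z | if z is inr _ then true else false].

(** Chosen so that every star has weight 1. *)
Definition uniform_weight (z : split_of B) : rat :=
  match z with inl u => 1 - c * #|[set v | badj u v]|%:R | inr _ => c end.

Lemma uniform_weight_ge0 z : 0 <= uniform_weight z.
Proof.
case: z => [u|v] /=; last exact: ltW.
rewrite subr_ge0; apply: le_trans c_le1.
by rewrite ler_pM2l // ler_nat max_card.
Qed.

Lemma weight_V_side : \sum_(z in V_side) uniform_weight z = c * #|bV B|%:R.
Proof.
rewrite big_sumType /= big_pred0 ?add0r => [|u]; last by rewrite inE.
rewrite (eq_bigl predT) => [|v]; last by rewrite inE.
by rewrite sumr_const mulr_natr.
Qed.

Lemma weight_star u : \sum_(z in star u) uniform_weight z = 1.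
Proof.
rewrite big_sumType /= (eq_bigl (pred1 u)) => [|u']; last by rewrite inE.
rewrite big_pred1_eq (eq_bigl (mem [set v | badj u v])) => [|v]; last by rewrite !inE.
by rewrite sumr_const mulr_natr subrK.
Qed.

Lemma weight_subset (K L : {set split_of B}) : K \subset L ->
  \sum_(z in K) uniform_weight z <= \sum_(z in L) uniform_weight z.
Proof.
move=> /setIidPr KL; rewrite [leRHS](big_setID K) /= KL lerDl.
by apply: sumr_ge0 => z _; apply: uniform_weight_ge0.
Qed.

Lemma weight_subset_eq (K L : {set split_of B}) v : K \subset L ->
  \sum_(z in K) uniform_weight z = \sum_(z in L) uniform_weight z ->
  (inr v \in K) = (inr v \in L).
Proof.
move=> KL eqw; apply/idP/idP => [/(subsetP KL)//|vL].
apply/negPn/negP => vK.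
have := weight_subset (K := inr v |: K) (L := L).
rewrite subUset sub1set vL KL => /(_ isT); rewrite big_setU1 //= -eqw.
by rewrite gerDr leNgt c_gt0.
Qed.

Lemma clique_star_or_V (K : {set split_of B}) : clique K ->
  (exists u, K \subset star u) \/ K \subset V_side.
Proof.
move=> /clique_set clK; have [u uK|noU] := pickP (fun u => inl u \in K).
  left; exists u; apply/subsetP => -[u'|v] zK; rewrite inE.
    by apply/negPn/negP => neu; have := clK (inl u') (inl u) zK uK neu.
  by have := clK (inl u) (inr v) uK zK isT.
by right; apply/subsetP => -[u|v]; rewrite inE // noU.
Qed.

(** A tight clique lies in a star, or in V with c |V| = 1; as the vertices of V have
    positive weight it then contains all vertices of V that the star, resp. the
    star of a full vertex, contains. *)
Lemma split_obstruction k (p : 'I_k -> bU B) (q : 'I_k -> bV B) :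
  bijective p -> injective q -> \det (square_mx p q) \notin zero_or_sign rat ->
  box_obstruction (fun j => inr (q j) : split_of B) (fun i => star (p i)) uniform_weight.
Proof.
move=> [p' pK p'K] qI detpq; split.
- by move=> j j' [] /qI.
- exact: uniform_weight_ge0.
- by [].
- move=> K /clique_star_or_V[[u]|] /weight_subset/le_trans; apply.
    by rewrite weight_star.
  by rewrite weight_V_side.
- move=> i; apply/clique_set => -[u|v] [u'|v']; rewrite !inE //=.
  + by move=> /eqP-> /eqP->; rewrite eqxx.
  + by move=> /eqP->.
  + by move=> + /eqP->.
- by move=> i; apply: weight_star.
- move=> K /clique_star_or_V[[u]|] KL wK.
    exists (p' u) => j; rewrite p'K; apply: weight_subset_eq => //.
    by rewrite weight_star.
  have wV : \sum_(z in V_side) uniform_weight z = 1.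
    apply: le_anti; rewrite [X in X <= _]weight_V_side c_le1 /=.
    by rewrite -wK weight_subset.
  have [u full] := c_full (etrans (esym weight_V_side) wV).
  exists (p' u) => j; rewrite p'K !inE full.
  by rewrite (weight_subset_eq _ KL) ?inE // wK wV.
apply: contraNN detpq => det3.
have -> : square_mx p q =
    map_mx intr (\matrix_(i, j) (inr (q j) \in star (p i))%:R : 'M[int]_k).
  by apply/matrixP => i j; rewrite !mxE inE rmorph_nat.
rewrite det_map_mx; move: det3; rewrite !inE => /or3P[] /eqP->;
  by rewrite ?rmorphN ?rmorph1 ?rmorph0 eqxx ?orbT.
Qed.
End SplitObstruction.

Lemma box_perfect_no_calS (G : sgraph) : box_perfect G ->
  ~ exists H : sgraph, calS H /\ induced_subgraph H G.
Proof.
move=> boxG [H [SH [b [bI bE]]]].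
suff [k [v [Q [x obs]]]] : exists k v Q x, @box_obstruction G k v Q x.
  exact: obstruction_not_box_perfect obs boxG.
case: SH b bI bE => {H} [B u|B] Q12.
  move=> fullu b bI bE.
  have QB : calQ B by case: Q12 => [[]|[QB notQ1 _]].
  have [k [p [q [pbij qbij det]]]] := calQ_squareP QB.
  have V0 : #|bV B|%:R != 0 :> rat.
    rewrite pnatr_eq0; apply: contraNneq det => V0.
    have := bij_eq_card qbij; rewrite card_ord V0 => k0.
    by move: p q {pbij qbij}; rewrite k0 => p q; rewrite det_mx00.
  have Vpos : 0 < #|bV B|%:R :> rat by rewrite lt0r V0 ler0n.
  pose c : rat := #|bV B|%:R^-1.
  have cV : c * #|bV B|%:R = 1 by rewrite mulVf.
  have obs := @split_obstruction B c _ _ _ k p q pbij (bij_inj qbij) det.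
  exists k; apply: (obstruction_transfer (b := b)
    (a := val : del_vertex (inl u : split_of B) -> _)
    val_inj _ bI bE _ (obs _ _ _)).
  - by [].
  (* The full vertex has weight 1 - c |V| = 0, hence is outside the support. *)
  - move=> h xh; have hu : h != inl u.
      apply: contraNneq xh => -> /=; rewrite (_ : [set v | _] = setT) ?cardsT ?cV ?subrr //.
      by apply/setP => v; rewrite !inE fullu.
    by exists (exist _ h hu).
  - by rewrite invr_gt0.
  - by rewrite cV.
  - by exists u.
move=> nofull b bI bE.
have QB : calQ B by case: Q12 => [[]|[]].
have [k [p [q [pbij qbij det]]]] := calQ_squareP QB.
pose c : rat := #|bV B|.+1%:R^-1.
have cV : c * #|bV B|%:R < 1.
  by rewrite mulrC ltr_pdivrMr ?ltr0n // mul1r ltr_nat.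
have obs := @split_obstruction B c _ _ _ k p q pbij (bij_inj qbij) det.
exists k; apply: (obstruction_transfer (a := @id (split_of B)) (b := b)
  (@inj_id _) _ bI bE _ (obs _ _ _)).
- by [].
- by move=> h _; exists h.
- by rewrite invr_gt0 ltr0n.
- exact: ltW.
- by move=> cV1; rewrite cV1 ltxx in cV.
Qed.

Theorem theorem2p3 (G : sgraph) (hG : split_graph G) :
  [<-> box_perfect G;
       ~ (exists H : sgraph, calS H /\ induced_subgraph H G);
       totally_unimodular_graph G].
Proof.
tfae.
- exact: box_perfect_no_calS.
- exact: TU_of_no_calS.
- exact: TU_box_perfect.
Qed.
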